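(* Let $n,p\ge1$ be integers and let $A=A^{p+1}_{n+1}$ with order $\le$, multiplication $\odot$ and residual $\Rightarrow$ as defined in the context. For all $a,b,c\in A$: $a\odot b\le c$ if and only if $b\le a\Rightarrow c$. Consequently $\langle A;\odot,\Rightarrow,\wedge,\vee,\bot,\top\rangle$ is a bounded integral commutative residuated lattice.
   Context: Order $\mathbb{Z}\times\mathbb{Z}$ lexicographically: $(m,r)\preccurlyeq(k,s)$ iff $m<k$, or $m=k$ and $r\le s$; addition/subtraction of pairs is componentwise, and $\min,\max$ of pairs refer to $\preccurlyeq$. For an integer $n\ge1$ let $L^\omega_{n+1}=\{(m,r)\in\mathbb{Z}^2:(0,0)\preccurlyeq(m,r)\preccurlyeq(n,0)\}$ with $x\ast y=\max\{(0,0),x+y-(n,0)\}$ and $x\to y=\min\{(n,0),(n,0)-x+y\}$. For an integer $p\ge1$ let $L_{p+1}=\{0,1,\dots,p\}$ with $\alpha\ast\beta=\max\{0,\alpha+\beta-p\}$. Define $$A=A^{p+1}_{n+1}=\{\langle(m,r),\alpha\rangle:(m,r)\in L^\omega_{n+1},\ \alpha\in\{0,p\}\}\cup\{\langle(m,r),\alpha\rangle:(0,0)\preccurlyeq(m,r)\preccurlyeq(n-1,0),\ 0<\alpha<p\}.$$ Order: $\langle(m,r),\alpha\rangle\le\langle(k,s),\beta\rangle$ iff one of: (o1) $\alpha\neq0$, $\alpha\le\beta$ and $(m,r)\preccurlyeq(k,s)$; (o2) $\alpha=\beta=0$ and $(k,s)\preccurlyeq(m,r)$; (o3) $\alpha=0$,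 $\beta\ne0$ and $(n-1,0)\preccurlyeq(m+k,r+s)$. $\wedge,\vee$ denote meet and join for $\le$. Put $\bot=\langle(n,0),0\rangle$, $\top=\langle(n,0),p\rangle$. For $a=\langle(m,r),\alpha\rangle$, $b=\langle(k,s),\beta\rangle\in A$ define $a\odot b$ by: (P1) if $\alpha,\beta\ge1$ and $\alpha+\beta>p$: $a\odot b=\langle(m,r)\ast(k,s),\alpha+\beta-p\rangle$; (P2) if $\alpha,\beta\ge1$ and $\alpha+\beta\le p$: $a\odot b=\langle\min\{(n,0),(2n-(m+k+1),-(r+s))\},0\rangle$; (P3) if $\alpha\ge1$, $\beta=0$: $a\odot b=\langle(m,r)\to(k,s),0\rangle$, and if $\alpha=0$, $\beta\ge1$: $a\odot b=\langle(k,s)\to(m,r),0\rangle$; (P4) if $\alpha=\beta=0$: $a\odot b=\langle\min\{(n,0),(m+k+1,r+s)\},0\rangle$. Define $\sim\langle(m,r),\alpha\rangle=\langle(m,r),p-\alpha\rangle$ if $\alpha\in\{0,p\}$, and $\sim\langle(m,r),\alpha\rangle=\langle(n-1-m,-r),p-\alpha\rangle$ if $0<\alpha<p$. Define $a\Rightarrow b=\sim(a\odot\sim b)$. *)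

(* Defs.v *)
From Stdlib Require Import ZArith Bool.
Open Scope Z_scope.

Definition pair := (Z * Z)%type.

Definition lexle (x y : pair) : bool :=
  (fst x <? fst y) || ((fst x =? fst y) && (snd x <=? snd y)).

Definition padd (x y : pair) : pair := (fst x + fst y, snd x + snd y).
Definition psub (x y : pair) : pair := (fst x - fst y, snd x - snd y).
Definition pmin (x y : pair) : pair := if lexle x y then x else y.
Definition pmax (x y : pair) : pair := if lexle x y then y else x.

Definition starL (n : Z) (x y : pair) : pair :=
  pmax (0, 0) (psub (padd x y) (n, 0)).
Definition impL (n : Z) (x y : pair) : pair :=
  pmin (n, 0) (padd (psub (n, 0) x) y).

(* An element <(m,r), alpha> is represented as ((m, r), alpha). *)
Definition elt := (pair * Z)%type.

Definition inA (n p : Z) (a : elt) : bool :=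
  let (x, al) := a in
  lexle (0, 0) x &&
  ( (((al =? 0) || (al =? p)) && lexle x (n, 0))
  || ((0 <? al) && (al <? p) && lexle x (n - 1, 0))).

Definition leA (n p : Z) (a b : elt) : bool :=
  let (x, al) := a in
  let (y, be) := b in
  negb (al =? 0) && (al <=? be) && lexle x y
  || (al =? 0) && (be =? 0) && lexle y x
  || (al =? 0) && negb (be =? 0) && lexle (n - 1, 0) (padd x y).

Definition odotA (n p : Z) (a b : elt) : elt :=
  let (x, al) := a in
  let (y, be) := b in
  if (1 <=? al) && (1 <=? be) then
    if p <? al + be then (starL n x y, al + be - p)
    else (pmin (n, 0) (2 * n - (fst x + fst y + 1), - (snd x + snd y)), 0)
  else if (1 <=? al) && (be =? 0) then (impL n x y, 0)
  else if (al =? 0) && (1 <=? be) then (impL n y x, 0)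
  else (pmin (n, 0) (fst x + fst y + 1, snd x + snd y), 0).

Definition negA (n p : Z) (a : elt) : elt :=
  let (x, al) := a in
  if (al =? 0) || (al =? p) then (x, p - al)
  else ((n - 1 - fst x, - snd x), p - al).

Definition impA (n p : Z) (a b : elt) : elt :=
  negA n p (odotA n p a (negA n p b)).

Definition botA (n : Z) : elt := ((n, 0), 0).
Definition topA (n p : Z) : elt := ((n, 0), p).

Record is_bicrl {T : Type} (S : T -> Prop) (le : T -> T -> Prop)
  (mul res : T -> T -> T) (bot top : T) : Prop := {
  rl_le_refl : forall a, S a -> le a a;
  rl_le_antisym : forall a b, S a -> S b -> le a b -> le b a -> a = b;
  rl_le_trans : forall a b c, S a -> S b -> S c -> le a b -> le b c -> le a c;
  rl_meet : forall a b, S a -> S b -> exists m, S m /\ le m a /\ le m b /\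
              (forall d, S d -> le d a -> le d b -> le d m);
  rl_join : forall a b, S a -> S b -> exists j, S j /\ le a j /\ le b j /\
              (forall d, S d -> le a d -> le b d -> le j d);
  rl_bot_in : S bot;
  rl_top_in : S top;
  rl_bot_least : forall a, S a -> le bot a;
  rl_top_greatest : forall a, S a -> le a top;
  rl_mul_closed : forall a b, S a -> S b -> S (mul a b);
  rl_res_closed : forall a b, S a -> S b -> S (res a b);
  rl_mul_assoc : forall a b c, S a -> S b -> S c ->
                   mul a (mul b c) = mul (mul a b) c;
  rl_mul_comm : forall a b, S a -> S b -> mul a b = mul b a;
  rl_mul_unit : forall a, S a -> mul top a = a;
  rl_residuation : forall a b c, S a -> S b -> S c ->
                     (le (mul a b) c <-> le b (res a c))
}.

(* Main.v *)
(** Everything reduces to the fact that [~] is an involution and that [a <= b]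
    holds exactly when [a (.) ~b] is the bottom: by associativity and
    commutativity, [a (.) b <= c] iff [a (.) b (.) ~c] is the bottom iff
    [b <= ~(a (.) ~c)].  Joins are explicit, and meets are obtained from them
    because [~] reverses the order. *)
Require Import Defs.
From Stdlib Require Import ZArith Bool Lia.
Open Scope Z_scope.

(** * Lexicographic inequalities as integer arithmetic *)

Lemma lexle_spec (x y : pair) :
  lexle x y = true <-> fst x < fst y \/ fst x = fst y /\ snd x <= snd y.
Proof. unfold lexle. rewrite orb_true_iff, andb_true_iff. lia. Qed.

Lemma lexle_false (x y : pair) :
  lexle x y = false <-> fst y < fst x \/ fst x = fst y /\ snd y < snd x.
Proof. rewrite <- not_true_iff_false, lexle_spec. lia. Qed.

Lemma inA_spec (n p : Z) (x : pair) (al : Z) :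
  1 <= p ->
  inA n p (x, al) = true <->
  lexle (0, 0) x = true /\ lexle x (n, 0) = true /\ 0 <= al <= p /\
  (0 < al < p -> lexle x (n - 1, 0) = true).
Proof.
  intro hp. unfold inA.
  rewrite ?andb_true_iff, ?orb_true_iff, ?andb_true_iff, ?orb_true_iff,
    ?lexle_spec.
  simpl. lia.
Qed.

Lemma leA_spec (n p : Z) (x y : pair) (al be : Z) :
  leA n p (x, al) (y, be) = true <->
  al <> 0 /\ al <= be /\ lexle x y = true \/
  al = 0 /\ be = 0 /\ lexle y x = true \/
  al = 0 /\ be <> 0 /\ lexle (n - 1, 0) (padd x y) = true.
Proof.
  unfold leA.
  rewrite ?orb_true_iff, ?andb_true_iff, ?negb_true_iff, ?Z.eqb_eq,
    ?Z.eqb_neq, ?Z.leb_le.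
  tauto.
Qed.

Ltac split_lex :=
  unfold starL, impL, pmin, pmax, padd, psub in *; cbn [fst snd] in *;
  repeat match goal with
  | |- context [if lexle ?x ?y then _ else _] =>
      let E := fresh "E" in destruct (lexle x y) eqn:E
  end;
  rewrite ?lexle_spec in *; rewrite ?lexle_false in *; cbn [fst snd] in *.

(* On pairs whose second components differ by less than [N], comparing codes is
   comparing lexicographically; as [code N] is additive, this turns lexicographic
   inequalities into linear ones, sparing [lia] the disjunctions of the order. *)
Definition code (N : Z) (x : pair) : Z := fst x * N + snd x.

(** A gap between the first components weighs at least [N], which the second components are too
    close together to make up. *)
Lemma lexle_code (N : Z) (x y : pair) :
  Z.abs (snd x - snd y) < N -> lexle x y = (code N x <=? code N y).
Proof.
  intro h. apply eq_true_iff_eq.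
  rewrite lexle_spec, Z.leb_le. unfold code. nia.
Qed.

Lemma code_inj (N : Z) (x y : pair) :
  Z.abs (snd x - snd y) < N -> code N x = code N y -> x = y.
Proof.
  destruct x as [m r], y as [k s]. unfold code. simpl. intros h e.
  assert (m = k) by nia. subst. f_equal. lia.
Qed.

Ltac bounded := unfold padd, psub; cbn [fst snd]; lia.

(** With [B] the sum of the absolute values of the second components, 8 leaves ample room for the
    sums and differences compared below. The existential keeps [N] an opaque variable, so that
    products such as [m * N] act as atoms. *)
Lemma exists_scale (B : Z) : exists N, 8 * B < N.
Proof. eexists. apply Z.lt_succ_diag_r. Qed.

Ltac encode N := rewrite !(lexle_code N), ?Z.leb_le by bounded.

Ltac split_lex_code N :=
  unfold starL, impL, pmin, pmax, padd, psub; cbn [fst snd];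
  repeat match goal with
  | |- context [if lexle ?x ?y then _ else _] =>
      rewrite (lexle_code N x y) by bounded;
      destruct (Z.leb_spec (code N x) (code N y)); cbn [fst snd]
  end.

Ltac code_lia := unfold code, padd, psub in *; cbn [fst snd] in *; lia.

Ltac split_levels :=
  repeat match goal with
  | |- context [?x <=? ?y] => destruct (Z.leb_spec x y)
  | |- context [?x <? ?y] => destruct (Z.ltb_spec x y)
  | |- context [?x =? ?y] => destruct (Z.eqb_spec x y)
  end; cbn beta iota delta [andb orb negb]; try lia.

Lemma elt_eq_iff (a b : elt) :
  a = b <->
  fst (fst a) = fst (fst b) /\ snd (fst a) = snd (fst b) /\ snd a = snd b.
Proof.
  destruct a as [[m r] al], b as [[k s] be]. simpl. intuition congruence.
Qed.

Ltac elt_eq := rewrite elt_eq_iff; cbn [fst snd]; lia.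

Section algebra.

Variables (n p : Z).
Hypotheses (hn : 1 <= n) (hp : 1 <= p).

(** * Product and negation *)

Lemma odotA_comm (a b : elt) :
  inA n p a = true -> inA n p b = true -> odotA n p a b = odotA n p b a.
Proof.
  destruct a as [[m r] al], b as [[k s] be].
  rewrite !inA_spec by assumption. intros Ha Hb.
  unfold odotA. split_levels; split_lex; elt_eq.
Qed.

Lemma odotA_top (a : elt) : inA n p a = true -> odotA n p (topA n p) a = a.
Proof.
  destruct a as [[m r] al].
  rewrite !inA_spec by assumption. intros Ha.
  unfold odotA, topA. split_levels; split_lex; elt_eq.
Qed.

Lemma odotA_closed (a b : elt) :
  inA n p a = true -> inA n p b = true -> inA n p (odotA n p a b) = true.
Proof.
  destruct a as [[m r] al], b as [[k s] be].
  rewrite !inA_spec by assumption. intros Ha Hb.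
  unfold odotA. split_levels; rewrite inA_spec by assumption; split_lex; lia.
Qed.

Lemma negA_closed (a : elt) : inA n p a = true -> inA n p (negA n p a) = true.
Proof.
  destruct a as [[m r] al].
  rewrite !inA_spec by assumption. intros Ha.
  unfold negA. split_levels; rewrite inA_spec by assumption; split_lex; lia.
Qed.

Lemma negA_involutive (a : elt) : inA n p a = true -> negA n p (negA n p a) = a.
Proof.
  destruct a as [[m r] al].
  rewrite !inA_spec by assumption. intros Ha.
  (* The level tests of the outer operation are exposed only once the first pass has evaluated the
     inner one, hence two passes. *)
  unfold negA. split_levels; split_levels; elt_eq.
Qed.

(** If [al >= 1] and [be = 0], the product keeps level [al] and is not the bottom. Otherwise it
    falls to level 0 exactly when [al <= be], and there the cap [(n, 0)] is reached exactly when the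
    inequality of pairs in (o1), (o2) or (o3) holds. *)
Lemma leA_iff_odotA_negA (a b : elt) :
  inA n p a = true -> inA n p b = true ->
  leA n p a b = true <-> odotA n p a (negA n p b) = botA n.
Proof.
  destruct a as [[m r] al], b as [[k s] be].
  rewrite !inA_spec, leA_spec by assumption. intros Ha Hb.
  unfold odotA, negA, botA. split_levels; split_levels; split_lex; elt_eq.
Qed.

Lemma odotA_assoc (a b c : elt) :
  inA n p a = true -> inA n p b = true -> inA n p c = true ->
  odotA n p a (odotA n p b c) = odotA n p (odotA n p a b) c.
Proof.
  destruct a as [[m r] al], b as [[k s] be], c as [[l t] ga].
  rewrite !inA_spec by assumption.
  destruct (exists_scale (Z.abs r + Z.abs s + Z.abs t)) as [N hN]. encode N.
  intros Ha Hb Hc. unfold odotA.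
  split_levels; split_levels; f_equal; try lia; split_lex_code N;
  (* Once the levels and all truncations are decided, equality of pairs is a linear equation between
     codes. *)
  (apply (code_inj N); [bounded | code_lia]).
Qed.

(** * Order, residuation and lattice operations *)

Lemma leA_refl (a : elt) : leA n p a a = true.
Proof.
  destruct a as [[m r] al].
  rewrite leA_spec, !lexle_spec. cbn [fst snd]. lia.
Qed.

Lemma leA_antisym (a b : elt) :
  inA n p a = true -> inA n p b = true ->
  leA n p a b = true -> leA n p b a = true -> a = b.
Proof.
  destruct a as [[m r] al], b as [[k s] be].
  rewrite !inA_spec, !leA_spec, !lexle_spec, elt_eq_iff by assumption.
  unfold padd. cbn [fst snd]. lia.
Qed.

Lemma leA_trans (a b c : elt) :
  inA n p a = true -> inA n p b = true -> inA n p c = true ->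
  leA n p a b = true -> leA n p b c = true -> leA n p a c = true.
Proof.
  destruct a as [[m r] al], b as [[k s] be], c as [[l t] ga].
  rewrite !inA_spec, !leA_spec by assumption.
  destruct (exists_scale (Z.abs r + Z.abs s + Z.abs t)) as [N hN].
  encode N. code_lia.
Qed.

Lemma botA_in : inA n p (botA n) = true.
Proof.
  unfold botA. rewrite inA_spec, !lexle_spec by assumption. cbn [fst snd]. lia.
Qed.

Lemma topA_in : inA n p (topA n p) = true.
Proof.
  unfold topA. rewrite inA_spec, !lexle_spec by assumption. cbn [fst snd]. lia.
Qed.

Lemma leA_botA (a : elt) : inA n p a = true -> leA n p (botA n) a = true.
Proof.
  destruct a as [[m r] al]. unfold botA.
  rewrite inA_spec, leA_spec, !lexle_spec by assumption.
  unfold padd. cbn [fst snd]. lia.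
Qed.

Lemma leA_topA (a : elt) : inA n p a = true -> leA n p a (topA n p) = true.
Proof.
  destruct a as [[m r] al]. unfold topA.
  rewrite inA_spec, leA_spec, !lexle_spec by assumption.
  unfold padd. cbn [fst snd]. lia.
Qed.

(** Since [~~a = a], both inequalities say that the product of [a] and [~b] is the bottom. *)
Lemma leA_negA (a b : elt) :
  inA n p a = true -> inA n p b = true -> leA n p a b = true ->
  leA n p (negA n p b) (negA n p a) = true.
Proof.
  intros Ha Hb.
  rewrite !leA_iff_odotA_negA, negA_involutive, odotA_comm
    by auto using negA_closed.
  trivial.
Qed.

Lemma impA_closed (a b : elt) :
  inA n p a = true -> inA n p b = true -> inA n p (impA n p a b) = true.
Proof. unfold impA. auto using negA_closed, odotA_closed. Qed.

Lemma odotA_residuation (a b c : elt) :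
  inA n p a = true -> inA n p b = true -> inA n p c = true ->
  leA n p (odotA n p a b) c = true <-> leA n p b (impA n p a c) = true.
Proof.
  intros Ha Hb Hc. unfold impA.
  (* After commuting [a] and [b], both sides multiply [b], [a], [~c] in this order and differ only
     in bracketing. *)
  rewrite !leA_iff_odotA_negA, negA_involutive, (odotA_comm a b), odotA_assoc
    by auto using negA_closed, odotA_closed.
  reflexivity.
Qed.

(** Level 0 carries the reversed order, hence [pmin] there. Below an element of nonzero level,
    [(x, 0)] acts through (o3) as the lower bound [(n - 1, 0) - x] on its pair, hence the mixed
    cases. *)
Definition joinA (a b : elt) : elt :=
  let (x, al) := a in
  let (y, be) := b in
  if al =? 0 then
    if be =? 0 then (pmin x y, 0) else (pmax (psub (n - 1, 0) x) y, be)
  else if be =? 0 then (pmax (psub (n - 1, 0) y) x, al)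
  else (pmax x y, Z.max al be).

Lemma joinA_lub (a b : elt) :
  inA n p a = true -> inA n p b = true ->
  inA n p (joinA a b) = true /\
  leA n p a (joinA a b) = true /\ leA n p b (joinA a b) = true /\
  (forall d, inA n p d = true -> leA n p a d = true -> leA n p b d = true ->
    leA n p (joinA a b) d = true).
Proof.
  destruct a as [[m r] al], b as [[k s] be].
  rewrite !inA_spec by assumption. intros Ha Hb.
  split; [| split; [| split]].
  1-3: destruct (exists_scale (Z.abs r + Z.abs s)) as [N hN];
    revert Ha Hb; encode N; intros Ha Hb;
    unfold joinA; split_levels;
    rewrite ?inA_spec, ?leA_spec by assumption;
    split_lex_code N; encode N; code_lia.
  intros [[l t] ga]. rewrite inA_spec by assumption.
  (* The competing upper bound brings in [t], so the scale is chosen only after it is introduced. *)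
  destruct (exists_scale (Z.abs r + Z.abs s + Z.abs t)) as [N hN].
  revert Ha Hb; rewrite !leA_spec; encode N; intros Ha Hb Hd Had Hbd.
  unfold joinA; split_levels; rewrite leA_spec;
  split_lex_code N; encode N; code_lia.
Qed.

Lemma meetA_glb (a b : elt) :
  inA n p a = true -> inA n p b = true ->
  exists m, inA n p m = true /\ leA n p m a = true /\ leA n p m b = true /\
    (forall d, inA n p d = true -> leA n p d a = true -> leA n p d b = true ->
      leA n p d m = true).
Proof.
  intros Ha Hb.
  destruct (joinA_lub (negA n p a) (negA n p b)) as (Hj & Hja & Hjb & Hlub);
    auto using negA_closed.
  exists (negA n p (joinA (negA n p a) (negA n p b))).
  apply leA_negA in Hja, Hjb; auto using negA_closed.
  rewrite negA_involutive in Hja, Hjb by assumption.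
  repeat split; auto using negA_closed.
  intros d Hd Hda Hdb.
  (* [~d] is an upper bound of [~a] and [~b], hence of their join; negating once more puts [d] below
     the meet. *)
  rewrite <- (negA_involutive d) by assumption.
  auto using leA_negA, negA_closed.
Qed.

End algebra.

Theorem theorem2p5 (n p : Z) (hn : 1 <= n) (hp : 1 <= p) :
  (forall a b c : elt, inA n p a = true -> inA n p b = true -> inA n p c = true ->
     (leA n p (odotA n p a b) c = true <-> leA n p b (impA n p a c) = true))
  /\ is_bicrl (fun a => inA n p a = true) (fun a b => leA n p a b = true)
       (odotA n p) (impA n p) (botA n) (topA n p).
Proof.
  split; [exact (odotA_residuation n p hn hp) |].
  constructor; intros;
    eauto using leA_refl, leA_antisym, leA_trans, meetA_glb, botA_in, topA_in,
      leA_botA, leA_topA, odotA_closed, impA_closed, odotA_assoc, odotA_comm,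
      odotA_top, odotA_residuation.
  (* Only the join is left, because [joinA_lub] is stated for an explicit witness. *)
  exists (joinA n a b). auto using joinA_lub.
Qed.
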